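(* Let $X=(X_1,\dots,X_d)$ be a random vector in $\mathbb{S}=[0,\infty)^d$ and let $I\subset\{1,\dots,d\}$ be non-empty. Assume there exists a function $b$, regularly varying at infinity with index $\alpha>0$, such that $\lim_{t\to\infty}b(t)\,\mathbb{P}(X_i>t)=c_i\in(0,\infty)$ for all $i\in I$. Assume that for every $i\in I$ the conditional law of $X/X_i$ given $X_i>t$ converges weakly as $t\to\infty$ to the law of some random vector $\Theta_i=(\Theta_{i,j})_{j=1}^d$ on $\mathbb{S}$. Then, for every Borel measurable $f:\mathbb{S}_{0,I}\to[0,\infty]$ and all $i,j\in I$, $$c_j\,\mathbb{E}\left[\mathbf 1\{\Theta_{j,i}>0\}\int_0^\infty f(z\Theta_j)\,\alpha z^{-\alpha-1}\,\mathrm dz\right]=c_i\,\mathbb{E}\left[\mathbf 1\{\Theta_{i,j}>0\}\int_0^\infty f(z\Theta_i)\,\alpha z^{-\alpha-1}\,\mathrm dz\right].$$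
   Context: A positive, measurable function $b$ defined on a neighbourhood of infinity is regularly varying with index $\tau$ if $b(\lambda t)/b(t)\to\lambda^\tau$ as $t\to\infty$ for all $\lambda>0$. $\mathbb{S}_{0,I}=\{x\in\mathbb{S}:\max_{i\in I}x_i>0\}$. Note that $\Theta_{i,i}=1$ almost surely, so that $z\Theta_i\in\mathbb{S}_{0,I}$ almost surely for $i\in I$ and $z>0$. *)

(* Defs.v *)
From HB Require Import structures.
From mathcomp Require Import all_boot all_order all_algebra.
From mathcomp Require Import all_classical all_reals all_analysis.
From mathcomp Require Import measurable_realfun.

Set Implicit Arguments.
Unset Strict Implicit.
Unset Printing Implicit Defensive.

Import Order.TTheory GRing.Theory Num.Theory.
Import numFieldNormedType.Exports.

Local Open Scope classical_set_scope.
Local Open Scope ring_scope.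

(* 'rV[R]_d carries no measurable structure in the library; this is R^d with
   its Borel sigma-algebra. The alias is convertible to 'rV[R]_d. *)
Notation borel_rV R d := (g_sigma_algebraType (@open 'rV[R]_d)).

Section vectors.
Context {R : realType} {d : nat}.

Definition coordinate (i : 'I_d) (x : 'rV[R]_d) : R := x ord0 i.

Definition orthant : set 'rV[R]_d := [set x | forall i, 0 <= coordinate i x].

(* The default value 0 of the iterated maximum is harmless: coordinates are
   nonnegative on the orthant. *)
Definition orthant_off0 (I : {set 'I_d}) : set 'rV[R]_d :=
  [set x | orthant x /\ 0 < \big[Order.max/0]_(i in I) coordinate i x].

(* Meaningful when coordinate i x != 0, by the convention 0^-1 = 0. *)
Definition self_normalize (i : 'I_d) (x : 'rV[R]_d) : 'rV[R]_d :=
  (coordinate i x)^-1 *: x.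

End vectors.

Definition regularly_varying {R : realType} (b : R -> R) (tau : R) : Prop :=
  (exists a : R, measurable_fun `]a, +oo[ b /\
                 forall t, a < t -> 0 < b t) /\
  (forall lambda : R, 0 < lambda ->
     b (lambda * t) / b t @[t --> +oo] --> lambda `^ tau).

Section laws.
Local Open Scope ereal_scope.

Definition cond_prob {dT} {T : measurableType dT} {R : realType}
    (P : probability T R) (A : set T) : set T -> \bar R :=
  fun B => P (B `&` A) * ((fine (P A))^-1)%:E.

Definition cond_law {dT dE} {T : measurableType dT} {E : measurableType dE}
    {R : realType} (P : probability T R) (A : set T) (Y : T -> E) :
    set E -> \bar R :=
  pushforward (cond_prob P A) Y.

(* Weak convergence, along the filter F, of laws on the subspace S of R^d:
   test functions are the bounded continuous functions on S. *)
Definition weak_cvg_on {R : realType} {d : nat} (S : set 'rV[R]_d)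
    {J : Type} (F : set_system J)
    (mu : J -> set (borel_rV R d) -> \bar R)
    (nu : set (borel_rV R d) -> \bar R) : Prop :=
  forall g : 'rV[R]_d -> R,
    {within S, continuous g} -> [bounded g x | x in S] ->
    \int[mu t]_(x in S) (g x)%:E @[t --> F] --> \int[nu]_(x in S) (g x)%:E.

End laws.

(* Main.v *)
(** The claim reduces to the time-change formula
      c_j E[h(Theta_j / Theta_ji) Theta_ji^alpha; Theta_ji > 0] = c_i E[h(Theta_i); Theta_ij > 0]
    for Borel h >= 0, applied to h(x) = \int_0^oo f(z x) alpha z^(-alpha-1) dz: this h is
    homogeneous of degree alpha, so the left side becomes c_j E[h(Theta_j); Theta_ji > 0].
    For h = g bounded and continuous, multiply by phi(x_j / x_i) with phi supported in a window
    [v, w]. There X_j > w t implies X_i > t, which in turn implies X_j > v t; hence, after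
    normalisation by b(t), the expectation over {X_i > t} is squeezed between expectations over
    {X_j > w t} and {X_j > v t}. The weak limits and regular variation of b then give the formula
    up to a factor (w / v)^alpha. Summing over a partition of unity on a geometric grid of ratio
    tending to 1, with Fatou's lemma, gives equality, and bounded continuous functions determine
    finite Borel measures. *)
Require Import Defs.
From HB Require Import structures.
From mathcomp Require Import all_boot all_order all_algebra.
From mathcomp Require Import all_classical all_reals all_analysis.
From mathcomp Require Import measurable_realfun.
Set Implicit Arguments.
Unset Strict Implicit.
Unset Printing Implicit Defensive.
Import Order.TTheory GRing.Theory Num.Theory.
Import numFieldNormedType.Exports.
Local Open Scope classical_set_scope.
Local Open Scope ring_scope.

(** * Borel measurability on [R^d]: coordinates, scaling, the orthant *)

Section borel_row_vectors.
Context {R : realType} {d : nat}.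

Lemma open_measurable_rV (U : set 'rV[R]_d) :
  open U -> measurable (U : set (borel_rV R d)).
Proof. by move=> oU; exact: sub_sigma_algebra. Qed.

Lemma continuous_measurable_rV (g : 'rV[R]_d -> R) :
  continuous g -> measurable_fun [set: borel_rV R d] g.
Proof.
move=> cg; apply: (measurability _ (RGenOpens.measurableE R)) => _ [_ [a [b ->]] <-].
rewrite setTI; apply: open_measurable_rV.
by apply: open_comp => [x _|]; [exact: cg|exact: interval_open].
Qed.

Lemma coordinate_continuous (i : 'I_d) : continuous (@coordinate R d i).
Proof. exact: coord_continuous. Qed.

Lemma measurable_coordinate (i : 'I_d) :
  measurable_fun [set: borel_rV R d] (coordinate i).
Proof. by apply: continuous_measurable_rV; exact: coordinate_continuous. Qed.

(** Every point of [U] lies in a box with rational centre and radius [1/(n+1)] that is contained in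
    [U]. The index set is countable, as measurability requires; boxes not contained in [U] are
    replaced by the empty set. *)
Lemma open_rV_bigcup_box (U : set 'rV[R]_d) : open U ->
  U = \bigcup_(p : 'rV[rat]_d * nat)
    (if `[< forall y, (forall i, `|ratr (p.1 ord0 i) - coordinate i y| < p.2.+1%:R^-1) -> U y >]
     then [set y | forall i, `|ratr (p.1 ord0 i) - coordinate i y| < p.2.+1%:R^-1]
     else set0).
Proof.
move=> oU; apply/seteqP; split => [x Ux|x [p _]]; last first.
  by case: asboolP => // pU; exact: pU.
have [e /= e0 xeU] : nbhs_ball x U by apply/nbhs_ballP; exact: open_nbhs_nbhs.
(* The factor 2 pays for the triangle inequality through the rational centre, which is within
   [1/(n+1)] of both [x] and [y]. *)
have [n ne] : exists n, 2 * n.+1%:R^-1 < e :> R.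
  have [n _ /(_ _ (leqnn n))/=] := near_infty_natSinv_lt (PosNum (divr_gt0 e0 (@ltr0n R 2))).
  by exists n; rewrite mulrC -ltr_pdivlMr.
have n0 : (0 < n.+1%:R^-1 :> R)%R by rewrite invr_gt0.
have qP (i : 'I_d) : exists q : rat, `|ratr q - coordinate i x| < n.+1%:R^-1 :> R.
  have [z [xz [q _ qz]]] := @dense_rat R (ball (coordinate i x) n.+1%:R^-1)
    (ex_intro _ (coordinate i x) (ballxx _ n0)) (ball_open _ _).
  by exists q; rewrite qz distrC.
have [q qx] := choice qP.
exists (\row_i q i, n) => //=; case: asboolP => [_ i|].
  by rewrite /= mxE.
case=> y qy; apply: xeU; split => // i j.
rewrite (ord1 i) /ball/=; apply: le_lt_trans ne.
rewrite (le_trans (ler_distD (ratr (q j)) _ _))// mulr_natl mulr2n lerD//.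
  by rewrite distrC ltW.
by have := qy j; rewrite mxE => /ltW.
Qed.

(** An open set is a countable union of boxes, and the preimage of a box is a finite intersection of
    conditions on single coordinates. *)
Lemma measurable_fun_rV dT (T : measurableType dT) (F : T -> borel_rV R d) :
  (forall i, measurable_fun setT (fun w => coordinate i (F w))) ->
  measurable_fun setT F.
Proof.
move=> mF; apply: (@measurability _ _ T (borel_rV R d) setT F (@open 'rV[R]_d)) => // _ [U oU <-].
rewrite setTI (open_rV_bigcup_box oU) preimage_bigcup.
apply: countable_bigcupT_measurable => [|p]; first exact: countableP.
case: ifPn => _; last by rewrite preimage_set0.
rewrite [X in measurable X](_ : _ = \bigcap_(i in [set: 'I_d])
    [set w | `|ratr (p.1 ord0 i) - coordinate i (F w)| < p.2.+1%:R^-1]); last first.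
  by apply/seteqP; split => w /=; [move=> h i _; exact: h|move=> h i; exact: h].
apply: fin_bigcap_measurable => // i _; rewrite -[X in measurable X]setTI.
rewrite (_ : [set w | _] = (coordinate i \o F) @^-1` ball (ratr (p.1 ord0 i) : R) p.2.+1%:R^-1) //.
by apply: (mF i) => //; exact: measurable_ball.
Qed.

Lemma measurable_scale_rV dT (T : measurableType dT) (z : T -> R)
    (F : T -> borel_rV R d) :
  measurable_fun setT z -> measurable_fun setT F ->
  measurable_fun setT (fun w => z w *: (F w : 'rV[R]_d) : borel_rV R d).
Proof.
move=> mz mF; apply: measurable_fun_rV => i.
rewrite [X in measurable_fun _ X](_ : _ = fun w => z w * coordinate i (F w)).
  by apply: measurable_funM => //; exact: measurableT_comp (measurable_coordinate i) mF.
by apply/funext => w; rewrite /coordinate mxE.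
Qed.

(** The point 0, where the inverse takes its default value, is split off; on the open complement
    inversion is continuous. *)
Lemma measurable_invr : measurable_fun [set: R] (fun x : R => x^-1).
Proof.
rewrite (_ : [set: R] = [set 0] `|` ~` [set 0]); last by rewrite setUv.
apply/measurable_funU => //; first exact: measurableC.
split; first exact: measurable_fun_set1.
apply: open_continuous_measurable_fun; first exact: closed_openC.
by move=> x; rewrite inE => /= /eqP x0; exact: inv_continuous.
Qed.

Lemma measurable_self_normalize (i : 'I_d) :
  measurable_fun [set: borel_rV R d]
    (fun x => self_normalize i x : borel_rV R d).
Proof.
apply: measurable_scale_rV => //.
exact: measurableT_comp measurable_invr (measurable_coordinate i).
Qed.

Lemma measurable_orthant : measurable (orthant : set (borel_rV R d)).
Proof.
rewrite [X in measurable X](_ : _ = \bigcap_(i in [set: 'I_d])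
    [set x : borel_rV R d | 0 <= coordinate i x]); last first.
  by apply/seteqP; split => w /=; [move=> h i _; exact: h|move=> h i; exact: h].
apply: fin_bigcap_measurable => // i _; rewrite -[X in measurable X]setTI.
rewrite (_ : [set x | _] = coordinate i @^-1` `[0, +oo[%classic).
  exact: measurable_coordinate.
by apply/seteqP; split => x /=; rewrite in_itv/= andbT.
Qed.

Lemma measurable_orthant_off0 (I : {set 'I_d}) :
  measurable (orthant_off0 I : set (borel_rV R d)).
Proof.
apply: measurableI; first exact: measurable_orthant.
pose m (x : borel_rV R d) := \big[Order.max/0]_(i in I) coordinate i x.
suff mm : measurable_fun setT m.
  rewrite (_ : (fun x => _) = setT `&` m @^-1` `]0, +oo[%classic); first exact: mm.
  by apply/seteqP; split => x /=; rewrite in_itv/= andbT => -[].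
suff H (s : seq 'I_d) (Q : pred 'I_d) : measurable_fun [set: borel_rV R d]
    (fun x => \big[Order.max/0]_(i <- s | Q i) coordinate i x) by exact: H.
elim: s => [|i s ih].
  by under eq_fun do rewrite big_nil; exact: measurable_cst.
case: (boolP (Q i)) => Qi; last by under eq_fun do rewrite big_cons (negbTE Qi).
under eq_fun do rewrite big_cons Qi.
by apply: measurable_maxr => //; exact: measurable_coordinate.
Qed.

End borel_row_vectors.

(** * Lebesgue measure under dilation *)

Section scaling.
Context {R : realType}.
Local Notation mu := (@lebesgue_measure R).

(** The right-hand side is a measure in [A] that gives half-open intervals their length, and
    Lebesgue measure is the only such measure. *)
Lemma lebesgue_measure_scale (a : R) (A : set R) : 0 < a -> measurable A ->
  mu A = (a%:E * mu ( *%R a @^-1` A))%E.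
Proof.
move=> a0.
have ma : measurable_fun [set: measurableTypeR R]
    ( *%R a : measurableTypeR R -> measurableTypeR R).
  exact: measurable_funM.
pose phi := *%R a : measurableTypeR R -> measurableTypeR R.
pose nu : {measure set (measurableTypeR R) -> \bar R} :=
  @mscale _ (measurableTypeR R) R (NngNum (ltW a0)) (pushforward mu phi).
move=> mA; apply: (@lebesgue_measure_unique _ (nu ma)) => // _ [[x y] _ <-].
rewrite /nu/= /mscale/= /pushforward.
rewrite (_ : _ @^-1` _ = `](x / a), (y / a)]%classic); last first.
  by apply/seteqP; split => z /=; rewrite !in_itv/= ltr_pdivrMr// ler_pdivlMr// (mulrC z).
rewrite !lebesgue_measure_itv/= !lte_fin ltr_pM2r ?invr_gt0//.
case: ifPn => _; last by rewrite mule0.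
by rewrite -!EFinD -EFinM -mulrBl mulrCA divff ?mulr1// gt_eqF.
Qed.

Lemma ge0_integral_scale (a : R) (G : R -> \bar R) : 0 < a ->
  measurable_fun setT G -> (forall z, 0 <= G z)%E ->
  (\int[mu]_(z in `]0%R, +oo[) G z =
   a%:E * \int[mu]_(z in `]0%R, +oo[) G (a * z)%R)%E.
Proof.
move=> a0 mG G0.
have ma : measurable_fun [set: measurableTypeR R]
    ( *%R a : measurableTypeR R -> measurableTypeR R).
  exact: measurable_funM.
pose phi := *%R a : measurableTypeR R -> measurableTypeR R.
pose nu : {measure set (measurableTypeR R) -> \bar R} :=
  @mscale _ (measurableTypeR R) R (NngNum (ltW a0)) (pushforward mu phi).
rewrite (@eq_measure_integral _ _ _ _ (nu ma)); last first.
  by move=> A mA _; exact: (lebesgue_measure_scale a0 mA).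
rewrite ge0_integral_mscale//=; last exact: measurable_funTS.
rewrite ge0_integral_pushforward//=; [|exact: measurable_funTS].
congr (_ * _)%E; congr integral; apply/seteqP.
by split => z /=; rewrite !in_itv/= !andbT pmulr_rgt0.
Qed.

End scaling.

(** * Measures given by a density *)

Section weighted_measure.
Local Open Scope ereal_scope.
Context d (T : measurableType d) (R : realType) (mu : {measure set T -> \bar R}).
Context (w : T -> \bar R) (mw : measurable_fun setT w) (w0 : forall x, 0 <= w x).

(** The proofs about [w] are arguments of the term so that a measure structure can be attached to
    it. *)
Definition weighted of measurable_fun setT w & (forall x, 0 <= w x) :=
  fun A : set T => \int[mu]_(x in A) w x.

Local Notation nu := (weighted mw w0).

Let nu0 : nu set0 = 0. Proof. exact: integral_set0. Qed.

Let nu_ge0 A : 0 <= nu A. Proof. by apply: integral_ge0 => x _. Qed.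

Let nu_sigma_additive : semi_sigma_additive nu.
Proof. exact: semi_sigma_additive_nng_induced. Qed.

HB.instance Definition _ := isMeasure.Build _ _ _ nu nu0 nu_ge0 nu_sigma_additive.

Import HBNNSimple.

Let integral_weighted_nnsfun (h : {nnsfun T >-> R}) :
  \int[nu]_x (h x)%:E = \int[mu]_x ((h x)%:E * w x).
Proof.
under [LHS]eq_integral do rewrite fimfunE -fsumEFin//.
rewrite [LHS]ge0_integral_fsum//; last 2 first.
  - by move=> r; exact/measurable_EFinP/measurableT_comp.
  - by move=> n x _; rewrite EFinM nnfun_muleindic_ge0.
under [RHS]eq_integral.
  move=> x _; rewrite fimfunE -fsumEFin// ge0_mule_fsuml; last first.
    by move=> r; rewrite EFinM nnfun_muleindic_ge0.
  over.
rewrite [RHS]ge0_integral_fsum//; last 2 first.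
  - move=> r; apply: emeasurable_funM => //.
    by apply/measurable_EFinP; do 2 apply/measurableT_comp => //.
  - by move=> r x _; rewrite mule_ge0// EFinM nnfun_muleindic_ge0.
apply: eq_fsbigr => r /set_mem[x _ rE].
have r0 : (0 <= r)%R by rewrite -rE.
rewrite integralZl_indic_nnsfun// integral_indic// setIT.
under [RHS]eq_integral do rewrite EFinM -muleA.
rewrite ge0_integralZl_EFin//; last 2 first.
  - by move=> y _; rewrite mule_ge0// lee_fin.
  - apply: emeasurable_funM => //; apply/measurable_EFinP.
    exact: measurable_indic.
congr (_ * _); rewrite -[LHS]/(\int[mu]_(x in h @^-1` [set r]) w x) integral_mkcond; apply: eq_integral => y _.
by rewrite patchE indicE; case: ifPn => _; rewrite ?mul1e ?mul0e.
Qed.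

(** The identity holds for simple functions by summing over level sets; monotone convergence,
    applied on both sides, extends it. *)
Lemma ge0_integral_weighted (f : T -> \bar R) :
  measurable_fun setT f -> (forall x, 0 <= f x) ->
  \int[nu]_x f x = \int[mu]_x (f x * w x).
Proof.
move=> mf f0; pose f_ := nnsfun_approx measurableT mf.
transitivity (limn (fun n => \int[nu]_x (f_ n x)%:E)).
  rewrite -monotone_convergence//=.
  - by apply: eq_integral => x _; apply/esym/cvg_lim => //; exact: cvg_nnsfun_approx.
  - by move=> n; exact/measurable_EFinP/measurable_funTS.
  - by move=> n x _; rewrite lee_fin.
  - by move=> x _ a b ab; rewrite lee_fin; exact/lefP/nd_nnsfun_approx.
under eq_fun do rewrite integral_weighted_nnsfun.
rewrite -monotone_convergence//=.
- apply: eq_integral => x _; apply/cvg_lim => //.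
  (* The limit of the product is the product of the limits except for the form [0 * oo], so the
     points where [w] or [f] vanishes are treated directly. *)
  have [wx|wx] := eqVneq (w x) 0.
    by rewrite wx mule0; under eq_fun do rewrite mule0; exact: cvg_cst.
  have [fx|fx] := eqVneq (f x) 0.
    have f_x n : f_ n x = 0%R.
      have : (f_ n x)%:E <= f x.
        have nd : nondecreasing_seq (fun m => (f_ m x)%:E).
          by move=> a b ab; rewrite lee_fin; exact/lefP/nd_nnsfun_approx.
        have fxE := cvg_nnsfun_approx measurableT mf (fun x _ => f0 x) Logic.I.
        rewrite (cvg_unique _ (fxE x) (ereal_nondecreasing_cvgn nd))//.
        by apply: ereal_sup_ubound; exists n.
      rewrite fx lee_fin => fnx; apply/eqP.
      by rewrite eq_le fnx fun_ge0.
    by rewrite fx mul0e; under eq_fun do rewrite f_x mul0e; exact: cvg_cst.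
  apply: cvgeM; [|exact: cvg_nnsfun_approx|exact: cvg_cst].
  by apply: neq0_mule_def; exact: mule_neq0.
- move=> n; apply: emeasurable_funM => //; exact/measurable_EFinP/measurable_funTS.
- by move=> n x _; rewrite mule_ge0// lee_fin.
- move=> x _ a b ab; rewrite lee_wpmul2r// lee_fin.
  exact/lefP/nd_nnsfun_approx.
Qed.

End weighted_measure.

(** * Finite Borel measures are determined by continuous functions *)

Section uniqueness.
Context {R : realType} {d : nat}.

(** The approximants are [min (n * del x) 1], where [del x] is the distance from [x] to the
    complement of [U]. *)
Lemma continuous_approx_open (U : set 'rV[R]_d) : open U ->
  exists g : nat -> 'rV[R]_d -> R, [/\ forall n, continuous (g n),
    forall n x, 0 <= g n x <= 1,
    forall x, nondecreasing_seq (g ^~ x) &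
    forall x, g ^~ x @ \oo --> (\1_U x : R)].
Proof.
move=> oU.
(* The distance to an empty complement would be infinite; in that case the constant 1 serves. *)
have [U0|/set0P[a aU]] := eqVneq (~` U) set0.
  have xU x : x \in U.
    by apply/mem_set; apply: contrapT => Ux; have : (~` U) x by []; rewrite U0.
  exists (fun _ _ => 1); split.
  - by move=> _; exact: cst_continuous.
  - by move=> _ x; rewrite ler01 lexx.
  - by move=> _ m n _; exact: lexx.
  - by move=> x; rewrite indicE xU; exact: cvg_cst.
pose del := fun z => fine (@edist_inf R _ (~` U) z).
have fin z : @edist_inf R _ (~` U) z \is a fin_num.
  rewrite ge0_fin_numE ?edist_inf_ge0//; apply: le_lt_trans.
    by apply: ereal_inf_lbound; exists a.
  rewrite -ge0_fin_numE ?edist_ge0//; apply/edist_finP => /=; exists (`|z - a| + 1).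
    by rewrite ltr_wpDl.
  by rewrite -ball_normE/= ltrDl.
have del0 z : 0 <= del z by rewrite fine_ge0 ?edist_inf_ge0.
have cdel : continuous del.
  move=> z; apply: (@fine_cvg _ _ _ _ (edist_inf (~` U)) (del z)).
    exact: nbhs_filter.
  by rewrite /del fineK//; exact: edist_inf_continuous.
have delU z : U z -> 0 < del z.
  move=> Uz; have /nbhs_ballP[e /= e0 zeU] := open_nbhs_nbhs (conj oU Uz).
  rewrite (lt_le_trans e0)// -lee_fin fineK//.
  apply: le_ereal_inf_tmp => _ [y Uy <-]; rewrite leNgt; apply/negP => zy.
  by apply: Uy; apply: zeU; exact: edist_lt_ball zy.
exists (fun n x => Num.min (n%:R * del x) 1); split.
- move=> n x; apply: (@continuous_min R _ (fun x => n%:R * del x) (fun=> 1)); last exact: cst_continuous.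
  by apply: (@continuousM R _ (fun=> n%:R) del); [exact: cst_continuous|exact: cdel].
- by move=> n x; rewrite ge_min lexx orbT le_min mulr_ge0// ler01.
- move=> x m n mn; rewrite le_min !ge_min lexx orbT andbT.
  by rewrite ler_wpM2r// ler_nat.
- move=> x; rewrite indicE; case: (boolP (x \in U)) => [/set_mem Ux|/negP Ux].
    (* From [n >= 1 / del x] on, the truncation at 1 is active. *)
    apply: cvg_near_cst; exists (Num.truncn (del x)^-1).+1 => // n /= xn.
    apply/min_idPr; rewrite -ler_pdivrMr ?delU// div1r.
    rewrite (le_trans (ltW (truncnS_gt _)))// ler_nat//.
  have -> : del x = 0.
    rewrite /del edist_inf0// => /mem_set//.
  under eq_fun do rewrite mulr0 min_l//; exact: cvg_cst.
Qed.

(** Open sets form a generating family stable under intersection, and the measure of an open set is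
    the limit of integrals of continuous functions increasing to its indicator. *)
Lemma measure_rV_unique (m1 m2 : {measure set (borel_rV R d) -> \bar R}) :
  (m1 setT < +oo)%E ->
  (forall g : 'rV[R]_d -> R, continuous g -> (forall x, 0 <= g x <= 1) ->
    (\int[m1]_x (g x)%:E = \int[m2]_x (g x)%:E)%E) ->
  forall A, measurable A -> m1 A = m2 A.
Proof.
move=> m1T m12.
apply: (@measure_unique _ R (borel_rV R d) (@open 'rV[R]_d) (fun=> setT)) => //.
- by move=> A B; exact: openI.
- by move=> _; exact: openT.
- by rewrite bigcup_const.
move=> U oU.
have mU : measurable (U : set (borel_rV R d)) by exact: open_measurable_rV.
have [g [cg g01 ndg gU]] := continuous_approx_open oU.
have H (m : {measure set (borel_rV R d) -> \bar R}) :
    (\int[m]_x (g n x)%:E @[n --> \oo] --> m U)%E.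
  rewrite (_ : m U = \int[m]_x (\1_U x)%:E)%E; last by rewrite integral_indic// setIT.
  rewrite (eq_integral (fun x : borel_rV R d => limn (fun n => (g n x)%:E))).
    apply: cvg_monotone_convergence => //.
    - by move=> n; apply/measurable_EFinP; exact: continuous_measurable_rV.
    - by move=> n x _; rewrite lee_fin; case/andP: (g01 n x).
    - by move=> x _ a b ab; rewrite lee_fin; exact: ndg.
  by move=> x _; apply/esym/cvg_lim => //; apply: cvg_EFin; [exact: nearW|exact: gU].
have := H m1; under eq_fun do rewrite m12//.
by move=> H1; exact: cvg_unique H1 (H m2).
Qed.

End uniqueness.

(** * A partition of unity on a geometric grid, and inequalities summed over it *)

Section windows.
Context {R : realType}.

(** For [s < t], the piecewise linear function that rises from 0 at [s] to 1 at [t]. *)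
Definition ramp (s t x : R) : R := Num.min 1 (Num.max 0 ((x - s) / (t - s))).

Lemma ramp_ge0 s t x : 0 <= ramp s t x.
Proof. by rewrite le_min ler01 le_max lexx. Qed.

Lemma ramp_le1 s t x : ramp s t x <= 1.
Proof. by rewrite ge_min lexx. Qed.

Lemma ramp_eq0 s t x : s < t -> x <= s -> ramp s t x = 0.
Proof.
move=> st xs; rewrite /ramp max_l ?min_r ?ler01//.
by rewrite ler_pdivrMr ?subr_gt0// mul0r subr_le0.
Qed.

Lemma ramp_eq1 s t x : s < t -> t <= x -> ramp s t x = 1.
Proof.
move=> st tx; rewrite /ramp min_l// le_max; apply/orP; right.
by rewrite ler_pdivlMr ?subr_gt0// mul1r lerD2r.
Qed.

Lemma ramp_continuous s t : continuous (ramp s t).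
Proof.
move=> x; apply: (@continuous_min R _ (fun=> 1) (fun x => Num.max 0 ((x - s) / (t - s)))).
  exact: cst_continuous.
apply: (@continuous_max R _ (fun=> 0) (fun x => (x - s) / (t - s))).
  exact: cst_continuous.
by apply: cvgMl; apply: cvgB; [exact: cvg_id|exact: cst_continuous].
Qed.

Lemma ramp_le s t u x : s < t -> t < u -> ramp t u x <= ramp s t x.
Proof.
move=> st tu; have [xt|tx] := leP x t; first by rewrite (ramp_eq0 tu xt) ramp_ge0.
by rewrite (ramp_eq1 st (ltW tx)) ramp_le1.
Qed.

Lemma bernoulli_ineq (e : R) n : 0 <= e -> 1 + n%:R * e <= (1 + e) ^+ n.
Proof.
move=> e0; elim: n => [|n ih]; first by rewrite mul0r addr0 expr0.
rewrite exprS (le_trans _ (ler_wpM2l _ ih)) ?addr_ge0//.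
by rewrite mulrDr mulr1 mulrDl mul1r -natr1 mulrDl mul1r addrA addrAC !addrA lerDl mulr_ge0// mulr_ge0.
Qed.

Lemma cvg_powR1 (alpha : R) (u : nat -> R) :
  u n @[n --> \oo] --> (1 : R) -> u n `^ alpha @[n --> \oo] --> (1 : R).
Proof.
move=> u1.
have H : expR (alpha * ln (u n)) @[n --> \oo] --> (1 : R).
  rewrite -[X in _ --> X]expR0 -(mulr0 alpha) -(@ln1 R).
  apply: continuous_cvg; first exact: continuous_expR.
  apply: cvgMr.
  by apply: continuous_cvg => //; exact: continuous_ln.
apply: cvg_trans H; apply: near_eq_cvg; near=> n.
have un0 : 0 < u n by near: n; apply: (cvgr_gt 1).
by rewrite /powR gt_eqF.
Unshelve. all: by end_near. Qed.

(* The teeth of [comb m] are supported in [[v k, v k.+2]] for the grid [v k = e (1 + e)^k] with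
   [e = 1 / (m + 1)], so that [v k.+2 / v k] tends to [1]; for [k < (m + 1)^3] they cover
   [[2 e, 1 / e]]. *)
Definition tooth (m k : nat) (x : R) : R :=
  let v j := m.+1%:R^-1 * (1 + m.+1%:R^-1) ^+ j in
  ramp (v k) (v k.+1) x - ramp (v k.+1) (v k.+2) x.

Definition comb (m : nat) (x : R) : R := \sum_(0 <= k < m.+1 ^ 3) tooth m k x.

Let e (m : nat) : R := m.+1%:R^-1.
Let v (m j : nat) : R := e m * (1 + e m) ^+ j.

Let e_gt0 m : 0 < e m. Proof. by rewrite invr_gt0. Qed.

Let v_gt0 m j : 0 < v m j.
Proof. by rewrite mulr_gt0// exprn_gt0// addr_gt0. Qed.

Let v_lt m j : v m j < v m j.+1.
Proof. by rewrite /v exprS mulrCA ltr_pMl ?v_gt0// ltrDl. Qed.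

(** Consecutive teeth share a ramp, so the sum telescopes. *)
Lemma combE m x : comb m x =
  ramp (v m 0) (v m 1) x - ramp (v m (m.+1 ^ 3)) (v m (m.+1 ^ 3).+1) x.
Proof.
rewrite /comb -[RHS]opprB -(@telescope_sumr _ _ _ (fun k => ramp (v m k) (v m k.+1) x))//.
by rewrite -sumrN; apply: eq_bigr => k _; rewrite opprB.
Qed.

Lemma comb_le1 m x : comb m x <= 1.
Proof. by rewrite combE lerBlDr (le_trans (ramp_le1 _ _ _))// lerDl ramp_ge0. Qed.

Lemma comb_le0 m x : x <= 0 -> comb m x = 0.
Proof.
by move=> x0; rewrite combE !ramp_eq0 ?subrr//; exact: (le_trans x0 (ltW (v_gt0 _ _))).
Qed.

Lemma comb_cvg x : comb m x @[m --> \oo] --> (\1_[set x : R | 0 < x] x : R).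
Proof.
rewrite indicE; have [x0|x0] := leP x 0.
  rewrite memNset; last by rewrite /= ltNge x0.
  by under eq_fun do rewrite comb_le0//; exact: cvg_cst.
rewrite mem_set//; apply: cvg_near_cst; near=> m.
(* The first ramp has reached 1 at [x] as soon as [v m 1 <= 2 / (m + 1) <= x]. *)
rewrite combE ramp_eq1//; last first.
  rewrite /v expr1 (@le_trans _ _ (2 * e m))//.
    rewrite mulrC ler_pM2r// lerD2l invf_le1//.
    by rewrite ler1n.
  rewrite mulrC -ler_pdivlMr// ltW//.
  near: m; exact: (near_infty_natSinv_lt (PosNum (divr_gt0 x0 (ltr0n R 2)))).
(* The last ramp is still 0 at [x]: by Bernoulli's inequality [v m ((m + 1)^3) >= e m + (m + 1)^3 (e
   m)^2 >= m + 1], which is why the comb has [(m + 1)^3] teeth. *)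
rewrite ramp_eq0 ?subr0//.
rewrite (@le_trans _ _ m.+1%:R)//.
  by rewrite (@le_trans _ _ m%:R) ?ler_nat//; near: m; exact: nbhs_infty_ger.
rewrite /v (le_trans _ (ler_wpM2l (ltW (e_gt0 m)) (bernoulli_ineq _ (ltW (e_gt0 m)))))//.
rewrite mulrDr ler_wpDl ?mulr1//; first exact: ltW.
by rewrite natrX /e !exprS expr0 mulr1 !mulrA mulVf ?mul1r ?mulfK.
Unshelve. all: by end_near. Qed.

Lemma tooth_ge0 m k x : 0 <= tooth m k x.
Proof. by rewrite subr_ge0 ramp_le// v_lt. Qed.

Lemma tooth_le1 m k x : tooth m k x <= 1.
Proof. by rewrite lerBlDr (le_trans (ramp_le1 _ _ _))// lerDl ramp_ge0. Qed.

Lemma tooth_continuous m k : continuous (tooth m k).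
Proof. by move=> x; apply: cvgB; exact: ramp_continuous. Qed.

Lemma tooth_supp m k x : tooth m k x != 0 -> v m k <= x <= v m k.+2.
Proof.
apply: contraR; rewrite negb_and -!ltNge => /orP[/ltW xv|/ltW xv].
  by rewrite /tooth !ramp_eq0 ?subrr// ?v_lt//; exact: (le_trans xv (ltW (v_lt _ _))).
rewrite /tooth !ramp_eq1 ?subrr// ?v_lt//.
by apply: le_trans xv; exact: (ltW (v_lt _ _)).
Qed.

Lemma comb_ge0 m x : 0 <= comb m x.
Proof. by apply: sumr_ge0 => k _; exact: tooth_ge0. Qed.

Section windows_integral.
Local Open Scope ereal_scope.
Context d1 (T1 : measurableType d1) d2 (T2 : measurableType d2).
Context (mu : {measure set T1 -> \bar R}) (nu : {measure set T2 -> \bar R}).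
Context (g1 h1 : T1 -> R) (g2 h2 : T2 -> R).
Context (mg1 : measurable_fun setT g1) (mh1 : measurable_fun setT h1).
Context (mg2 : measurable_fun setT g2) (mh2 : measurable_fun setT h2).
Context (g1_ge0 : forall x, (0 <= g1 x)%R) (g2_ge0 : forall x, (0 <= g2 x)%R).

(** The hypothesis is applied to each tooth of [comb m] and summed. Every tooth costs the same
    constant, which tends to 1 with [m]; on the right the comb is bounded by the indicator, and on
    the left Fatou's lemma lets it converge to the indicator. *)
Lemma le_integral_windows (alpha : R) :
  (forall (v w : R) (phi : R -> R), (0 < v)%R -> (v < w)%R -> continuous phi ->
    (forall x, 0 <= phi x <= 1)%R -> (forall x, phi x != 0 -> v <= x <= w)%R ->
    \int[mu]_x (g1 x * phi (h1 x))%:E <=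
    ((w / v) `^ alpha)%:E * \int[nu]_x (g2 x * phi (h2 x))%:E) ->
  \int[mu]_x (g1 x * \1_[set y : R | (0 < y)%R] (h1 x))%:E <=
  \int[nu]_x (g2 x * \1_[set y : R | (0 < y)%R] (h2 x))%:E.
Proof.
move=> H; set I2 := (leRHS).
have mtooth m k : measurable_fun setT (tooth m k).
  by apply: continuous_measurable_fun; exact: tooth_continuous.
have mcomb m : measurable_fun setT (comb m).
  by apply: measurable_sum => k; exact: mtooth.
have mpos : measurable_fun setT (\1_[set y : R | (0 < y)%R] : R -> R).
  apply: measurable_indic.
  rewrite (_ : [set _ | _] = `]0%R, +oo[%classic) //.
  by apply/seteqP; split => y /=; rewrite in_itv/= andbT.
(* From here on the right-hand side is finite, so that multiplication by it is continuous when the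
   constants tend to 1. *)
have [->|I2oo] := eqVneq I2 +oo; first exact: leey.
have I20 : 0 <= I2.
  by apply: integral_ge0 => x _; rewrite lee_fin mulr_ge0//.
have I2fin : I2 \is a fin_num by rewrite ge0_fin_numE// ltey.
(* The support of a tooth spans two steps of the grid, so its endpoints have ratio [(1 + e m)^2],
   whatever [k] is. *)
pose c m : R := (((1 + e m) ^+ 2) `^ alpha)%R.
have le_c m : \int[mu]_x (g1 x * comb m (h1 x))%:E <= (c m)%:E * I2.
  have E d (T : measurableType d) (la : {measure set T -> \bar R}) (g h : T -> R) :
      measurable_fun setT g -> measurable_fun setT h -> (forall x, 0 <= g x)%R ->
      \int[la]_x (g x * comb m (h x))%:E =
      \sum_(0 <= k < m.+1 ^ 3) \int[la]_x (g x * tooth m k (h x))%:E.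
    move=> mg mh g0; rewrite -ge0_integral_sum//.
    - by apply: eq_integral => x _; rewrite mulr_sumr -sumEFin.
    - move=> k; apply/measurable_EFinP; apply: measurable_funM => //.
      exact: measurableT_comp.
    - by move=> k x _; rewrite lee_fin mulr_ge0// tooth_ge0.
  apply: (@le_trans _ _ ((c m)%:E * \int[nu]_x (g2 x * comb m (h2 x))%:E)).
    rewrite !E// ge0_sume_distrr; last first.
      by move=> k _; apply: integral_ge0 => x _; rewrite lee_fin mulr_ge0// tooth_ge0.
    apply: lee_sum => k _.
    rewrite (_ : c m = ((v m k.+2 / v m k) `^ alpha)%R); last first.
      congr (_ `^ _)%R; apply/(canRL (mulfK _)); first by rewrite gt_eqF// v_gt0.
      by rewrite /v mulrCA -exprD.
    apply: H; first exact: v_gt0.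
    - exact: lt_trans (v_lt _ _) (v_lt _ _).
    - exact: tooth_continuous.
    - by move=> x; rewrite tooth_ge0 tooth_le1.
    - exact: tooth_supp.
  rewrite lee_wpmul2l ?lee_fin ?powR_ge0//.
  apply: ge0_le_integral => //.
  - by move=> x _; rewrite lee_fin mulr_ge0// comb_ge0.
  - by apply/measurable_EFinP; apply: measurable_funM => //; exact: measurableT_comp.
  - by apply/measurable_EFinP; apply: measurable_funM => //; exact: measurableT_comp.
  - move=> x _; rewrite lee_fin ler_wpM2l// indicE; have [x0|x0] := leP (h2 x) 0%R.
      by rewrite comb_le0.
    by rewrite mem_set// comb_le1.
have c1 : (c m)%:E * I2 @[m --> \oo] --> I2.
  rewrite -[X in _ --> X]mul1e; apply: cvgeZr => //.
  apply: cvg_EFin; first exact: nearW.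
  apply: cvg_powR1; rewrite -[X in _ --> X](expr1n _ 2).
  apply: (@cvg_comp _ _ _ (fun m => 1 + e m)%R (fun x => x ^+ 2)%R); last exact: exprn_continuous.
  suff : (1 + e m)%R @[m --> \oo] --> (1 + 0 : R)%R by rewrite addr0.
  by apply: cvgD; [exact: cvg_cst|exact: cvg_harmonic].
rewrite (eq_integral (fun x => limn_einf (fun m => (g1 x * comb m (h1 x))%:E))); last first.
  move=> x _; apply/esym; apply: (cvg_limn_einf_sup _).1.
  by apply: cvg_EFin; [exact: nearW|apply: cvgMr; exact: comb_cvg].
apply: (le_trans (fatou mu measurableT _ _)).
- by move=> n; apply/measurable_EFinP; apply: measurable_funM => //; exact: measurableT_comp.
- by move=> n x _; rewrite lee_fin mulr_ge0// comb_ge0.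
rewrite limn_einf_lim -(cvg_lim _ c1)//; apply: lee_lim.
- exact: is_cvg_einfs.
- by apply/cvg_ex; exists I2.
- apply: nearW => m; apply: le_trans (le_c m).
  by apply: ereal_inf_lbound; exists m => /=.
Qed.

End windows_integral.
End windows.

(** * Tail expectations and their limits after normalisation by [b] *)

Lemma ge0_integral_mrestr d (T : measurableType d) (R : realType)
    (mu : {measure set T -> \bar R}) (A : set T) (mA : measurable A) (f : T -> \bar R) :
  measurable_fun setT f -> (forall x, 0 <= f x)%E ->
  (\int[mrestr mu mA]_x f x = \int[mu]_(x in A) f x)%E.
Proof.
move=> mf f0.
have mi : measurable_fun setT (fun x => (\1_A x)%:E : \bar R).
  by apply/measurable_EFinP; exact: measurable_indic.
have i0 x : (0 <= (\1_A x)%:E :> \bar R)%E by rewrite lee_fin.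
(* The restriction of [mu] to [A] is the measure with density [\1_A]. *)
transitivity (\int[weighted mu mi i0]_x f x)%E.
  apply: eq_measure_integral => B mB _.
  by rewrite -[RHS]/(\int[mu]_(x in B) (\1_A x)%:E)%E integral_indic// setIC.
rewrite ge0_integral_weighted// [RHS]integral_mkcond; apply: eq_integral => x _.
by rewrite patchE indicE; case: ifPn => _; rewrite ?mule1 ?mule0.
Qed.

Lemma integral_prob_fin_num d (T : measurableType d) (R : realType)
    (Q : probability T R) (f : T -> R) :
  measurable_fun setT f -> (forall x, 0 <= f x <= 1) ->
  (\int[Q]_x (f x)%:E)%E \is a fin_num.
Proof.
move=> mf f01.
have f0 x : (0 <= (f x)%:E)%E by rewrite lee_fin; case/andP: (f01 x).
rewrite ge0_fin_numE; last exact: integral_ge0.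
apply: (@le_lt_trans _ _ (\int[Q]_w (cst 1%:E w))%E); last first.
  by rewrite integral_cst// mul1e -ge0_fin_numE// fin_num_measure.
apply: ge0_le_integral => //; first exact/measurable_EFinP.
by move=> w _; rewrite lee_fin; case/andP: (f01 w).
Qed.

Section tails.
Context (R : realType) (d : nat).
Context (dT : measure_display) (T : measurableType dT) (P : probability T R).
Context (X : {RV P >-> borel_rV R d}) (XS : forall w, orthant (X w)).

Let exceed (i : 'I_d) (t : R) := [set w | t < coordinate i (X w)].
Let Y (i : 'I_d) (w : T) : borel_rV R d := self_normalize i (X w).

Lemma measurable_exceed i t : measurable (exceed i t).
Proof.
rewrite (_ : exceed i t = (coordinate i \o X) @^-1` `]t, +oo[%classic).
  rewrite -[X in measurable X]setTI; apply: measurableT_comp => //.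
  exact: measurable_coordinate.
by apply/seteqP; split => w; rewrite /exceed/= in_itv/= andbT.
Qed.

Lemma measurable_normalized i : measurable_fun setT (Y i).
Proof. by apply: measurableT_comp => //; exact: measurable_self_normalize. Qed.

Lemma self_normalize_orthant (i : 'I_d) (x : 'rV[R]_d) :
  orthant x -> orthant (self_normalize i x).
Proof.
by move=> x0 j; rewrite /self_normalize /coordinate mxE mulr_ge0 ?invr_ge0//; exact: x0.
Qed.

(** The conditional law is a scaled pushforward of the restriction of [P] to the event, and its
    scaling factor cancels against [P (exceed i t)]. *)
Lemma integral_cond_law i t (g : 'rV[R]_d -> R) :
  measurable_fun [set: borel_rV R d] g -> (forall x, 0 <= g x) ->
  (P (exceed i t) *
   \int[cond_law P (exceed i t) (Y i)]_(x in orthant) (g x)%:E =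
   \int[P]_(w in exceed i t) (g (Y i w))%:E)%E.
Proof.
move=> mg g0; have mA := measurable_exceed i t.
have mgY : measurable_fun setT (fun w => (g (Y i w))%:E).
  by apply/measurable_EFinP; apply: measurableT_comp => //; exact: measurable_normalized.
have gY0 w : (0 <= (g (Y i w))%:E)%E by rewrite lee_fin.
have k0 : 0 <= (fine (P (exceed i t)))^-1 by rewrite invr_ge0 fine_ge0.
pose nu : {measure set (borel_rV R d) -> \bar R} :=
  mscale (NngNum k0) (pushforward (mrestr P mA) (Y i)).
have -> : cond_law P (exceed i t) (Y i) = nu (measurable_normalized i).
  by apply/funext => B; rewrite /nu/= /mscale/= /cond_law /cond_prob /pushforward /mrestr muleC.
rewrite ge0_integral_mscale//=; last 3 first.
- exact: measurable_orthant.
- by apply/measurable_funTS/measurable_EFinP.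
- by move=> x _; rewrite lee_fin.
rewrite ge0_integral_pushforward//=; last 4 first.
- exact: measurable_normalized.
- exact: measurable_orthant.
- by apply/measurable_funTS/measurable_EFinP.
- by move=> x _; rewrite lee_fin.
rewrite (_ : Y i @^-1` orthant = setT); last first.
  by apply/seteqP; split => // w _; exact: self_normalize_orthant.
rewrite ge0_integral_mrestr//.
(* If the event is null, the factor is [0^-1 = 0] and nothing cancels, but both sides vanish. *)
have [PA0|PA0] := eqVneq (P (exceed i t)) 0%E.
  by rewrite PA0 mul0e null_set_integral//; exact: measurable_funTS.
rewrite muleA -[X in (X * _%:E)%E]fineK ?fin_num_measure// -EFinM divff ?mul1e//.
by rewrite fine_eq0 ?fin_num_measure.
Qed.

Context (b : R -> R) (alpha : R) (b_rv : regularly_varying b alpha).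

Section one_index.
Context (i : 'I_d) (c : R).
Context (b_lim : ((b t)%:E * P (exceed i t))%E @[t --> +oo] --> c%:E).
Context (dT' : measure_display) (T' : measurableType dT') (Q : probability T' R).
Context (Theta : {RV Q >-> borel_rV R d}) (ThetaS : forall w, orthant (Theta w)).
Context (weak_lim : weak_cvg_on orthant (pinfty_nbhs R)
  (fun t => cond_law P (exceed i t) (Y i)) (distribution Q Theta)).

(** The expression is [b t * P (exceed i t)], which tends to [c], times a conditional expectation,
    which converges by the weak limit. *)
Lemma tail_cvg (g : 'rV[R]_d -> R) : continuous g -> (forall x, 0 <= g x <= 1) ->
  ((b t)%:E * \int[P]_(w in exceed i t) (g (Y i w))%:E)%E @[t --> +oo] -->
  (c%:E * \int[Q]_w (g (Theta w))%:E)%E.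
Proof.
move=> cg g01.
have g0 x : 0 <= g x by case/andP: (g01 x).
have mg := continuous_measurable_rV cg.
have mgT : measurable_fun setT (fun w => (g (Theta w))%:E).
  by apply/measurable_EFinP; exact: measurableT_comp.
have QE : (\int[distribution Q Theta]_(x in orthant) (g x)%:E =
           \int[Q]_w (g (Theta w))%:E)%E.
  rewrite ge0_integral_pushforward//=.
  - congr integral; apply/seteqP; split => // w _; exact: ThetaS.
  - exact: measurable_orthant.
  - by apply/measurable_funTS/measurable_EFinP.
  - by move=> x _; rewrite lee_fin.
have Qfin : (\int[Q]_w (g (Theta w))%:E)%E \is a fin_num.
  by apply: integral_prob_fin_num => //; exact: measurableT_comp.
under eq_fun do rewrite -integral_cond_law// muleA.
apply: cvgeM => //.
  by rewrite -(fineK Qfin).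
rewrite -QE; apply: weak_lim; first exact: continuous_subspaceT.
exists 1; split; first exact: num_real.
move=> M M1 x _; case/andP: (g01 x) => _ gx1.
by rewrite /= ger0_norm// (le_trans gx1)// ltW.
Qed.

(** Writing [b t] as [b (lambda t)] divided by [b (lambda t) / b t] reduces to the previous limit
    along [lambda t]; regular variation handles the quotient. *)
Lemma tail_scale_cvg (g : 'rV[R]_d -> R) (lambda : R) : 0 < lambda ->
  continuous g -> (forall x, 0 <= g x <= 1) ->
  ((b t)%:E * \int[P]_(w in exceed i (lambda * t)) (g (Y i w))%:E)%E @[t --> +oo] -->
  (((lambda `^ alpha)^-1)%:E * (c%:E * \int[Q]_w (g (Theta w))%:E))%E.
Proof.
move=> l0 cg g01; have H := tail_cvg cg g01.
have [[a [_ ba]] brv] := b_rv.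
have Qfin : (\int[Q]_w (g (Theta w))%:E)%E \is a fin_num.
  apply: integral_prob_fin_num => //; apply: measurableT_comp => //.
  exact: continuous_measurable_rV.
have lt : lambda * t @[t --> +oo] --> +oo by apply: gt0_cvgMry => //; exact: cvg_id.
have H1 := cvg_comp _ _ lt H.
have H2 : ((b (lambda * t) / b t)^-1)%:E @[t --> +oo] --> ((lambda `^ alpha)^-1)%:E.
  apply: cvg_EFin; first exact: nearW.
  apply: cvgV; last exact: brv.
  by rewrite gt_eqF// powR_gt0.
have fin_mul : (((lambda `^ alpha)^-1)%:E *? (c%:E * \int[Q]_w (g (Theta w))%:E))%E.
  by rewrite -(fineK Qfin) -EFinM.
apply: cvg_trans (cvgeM fin_mul H2 H1).
apply: near_eq_cvg; near=> t => /=.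
(* Positivity of [b] is known only beyond [a], so [t] has to exceed both [a] and [a / lambda]. *)
have bt : b t != 0.
  by rewrite gt_eqF//; apply: ba; near: t; apply: nbhs_pinfty_gt; exact: num_real.
have blt : b (lambda * t) != 0.
  rewrite gt_eqF//; apply: ba; rewrite mulrC -ltr_pdivrMr//.
  by near: t; apply: nbhs_pinfty_gt; exact: num_real.
by rewrite muleA -EFinM invf_div mulfVK.
Unshelve. all: by end_near. Qed.

End one_index.
End tails.

(** * Windowed test functions and the pathwise squeeze *)

Section window_functions.
Context {R : realType} {d : nat} (i j : 'I_d) (g : 'rV[R]_d -> R) (phi : R -> R).
Context (cg : continuous g) (g01 : forall x, 0 <= g x <= 1).
Context (cphi : continuous phi) (phi01 : forall x, 0 <= phi x <= 1).
Context (v w : R) (v0 : 0 < v) (vw : v < w).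
Context (phi_supp : forall x, phi x != 0 -> v <= x <= w).

(** Evaluated at [y = x / x_i], so that the window constrains the ratio [x_j / x_i]. *)
Definition windowed (y : 'rV[R]_d) : R := g y * phi (coordinate j y).

(* When [x_j != 0] this is [windowed] at [x / x_i], read off from [y = x / x_j]. Since [phi] is
   supported away from [0] and [oo], it vanishes for [y_i] close to [0] (with [0^-1 = 0]), whence
   its continuity there. *)
Definition renormalized (y : 'rV[R]_d) : R :=
  g (self_normalize i y) * phi (coordinate i y)^-1.

Let mul01 (a b : R) : 0 <= a <= 1 -> 0 <= b <= 1 -> 0 <= a * b <= 1.
Proof. by move=> /andP[a0 a1] /andP[b0 b1]; rewrite mulr_ge0//= mulr_ile1. Qed.

Lemma windowed_ge0_le1 y : 0 <= windowed y <= 1.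
Proof. exact: mul01. Qed.

Lemma renormalized_ge0_le1 y : 0 <= renormalized y <= 1.
Proof. exact: mul01. Qed.

Lemma windowed_continuous : continuous windowed.
Proof.
move=> y; apply: (@continuousM R _ g (phi \o coordinate j)); first exact: cg.
by apply: continuous_comp; [exact: coordinate_continuous|exact: cphi].
Qed.

Lemma renormalized_supp y :
  renormalized y != 0 -> w^-1 <= coordinate i y <= v^-1.
Proof.
rewrite mulf_eq0 negb_or => /andP[_ /phi_supp/andP[vy yw]].
have y0 : 0 < coordinate i y by rewrite -invr_gt0 (lt_le_trans v0).
have w0 := lt_trans v0 vw.
by rewrite -[coordinate i y]invrK !lef_pV2 ?posrE ?invr_gt0// vy yw.
Qed.

Lemma renormalized_continuous : continuous renormalized.
Proof.
have w0 := lt_trans v0 vw; move=> y.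
have cy : {for y, continuous (coordinate i)} by exact: coordinate_continuous.
(* Below [1 / w] the function vanishes on a neighbourhood; from [1 / w] on the coordinate is nonzero
   and inversion is continuous. *)
have [yw|yw] := ltP (coordinate i y) w^-1.
  have z0 z : coordinate i z < w^-1 -> renormalized z = 0.
    by move=> zw; apply/eqP; apply: contraTT zw => /renormalized_supp/andP[wz _]; rewrite -leNgt.
  have zy : \forall z \near y, coordinate i z < w^-1 := cvgr_lt (FF := nbhs_filter y) _ cy _ yw.
  rewrite /continuous_at (z0 _ yw); apply: (@cvg_near_cst _ _ _ _ _ (nbhs_filter y)).
  by apply: filterS zy => z; exact: z0.
have y0 : coordinate i y != 0 by rewrite gt_eqF// (lt_le_trans _ yw)// invr_gt0.
have cV : {for y, continuous (fun z => (coordinate i z)^-1)} by exact: continuousV.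
apply: (@continuousM R _ (fun z => g (self_normalize i z)) (fun z => phi (coordinate i z)^-1)).
  apply: continuous_comp; last exact: cg.
  by apply: (@continuousZ _ _ _ (fun z => (coordinate i z)^-1) id y); [exact: cV|exact: cvg_id].
by apply: continuous_comp; [exact: cV|exact: cphi].
Qed.

Lemma coordinate_self_normalize (k l : 'I_d) (x : 'rV[R]_d) :
  coordinate k (self_normalize l x) = (coordinate l x)^-1 * coordinate k x.
Proof. by rewrite /self_normalize /coordinate mxE. Qed.

(** The factor [x_j] cancels in [(x / x_j) / (x_i / x_j)]. If [x_i = 0], both sides use the same
    default inverse. *)
Lemma renormalizedE x : coordinate j x != 0 ->
  renormalized (self_normalize j x) = windowed (self_normalize i x).
Proof.
move=> xj; rewrite /renormalized /windowed {1}/self_normalize !coordinate_self_normalize.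
rewrite (_ : (_ * _)^-1 = (coordinate i x)^-1 * coordinate j x); last first.
  by rewrite invfM invrK mulrC.
by rewrite /self_normalize scalerA mulfK.
Qed.

Lemma windowed_supp x : windowed (self_normalize i x) != 0 ->
  v <= (coordinate i x)^-1 * coordinate j x <= w.
Proof.
rewrite mulf_eq0 negb_or => /andP[_ /phi_supp].
by rewrite coordinate_self_normalize.
Qed.

(** In the window [x_j >= v x_i], so [x_i > t] forces [x_j > v t], and there the two functions
    agree. *)
Lemma windowed_le t x : 0 < t -> orthant x ->
  (if t < coordinate i x then windowed (self_normalize i x) else 0) <=
  (if v * t < coordinate j x then renormalized (self_normalize j x) else 0).
Proof.
move=> t0 x0.
have rest0 : 0 <= (if v * t < coordinate j x then renormalized (self_normalize j x) else 0).
  by case: ifP => // _; case/andP: (renormalized_ge0_le1 (self_normalize j x)).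
case: ifPn => // tx.
have [->//|/windowed_supp/andP[vx _]] := eqVneq (windowed (self_normalize i x)) 0.
have vtx : v * t < coordinate j x.
  rewrite (@lt_le_trans _ _ (v * coordinate i x)) ?ltr_pM2l//.
  by rewrite -ler_pdivlMr 1?mulrC// (lt_trans t0).
by rewrite vtx renormalizedE// gt_eqF// (lt_trans _ vtx)// mulr_gt0.
Qed.

(** In the window [x_j <= w x_i], so [x_j > w t] forces [x_i > t]. *)
Lemma renormalized_le t x : 0 < t -> orthant x ->
  (if w * t < coordinate j x then renormalized (self_normalize j x) else 0) <=
  (if t < coordinate i x then windowed (self_normalize i x) else 0).
Proof.
move=> t0 x0; have w0 := lt_trans v0 vw.
have rest0 : 0 <= (if t < coordinate i x then windowed (self_normalize i x) else 0).
  by case: ifP => // _; case/andP: (windowed_ge0_le1 (self_normalize i x)).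
case: ifPn => // tx.
have xj0 : 0 < coordinate j x by rewrite (lt_trans _ tx)// mulr_gt0.
rewrite renormalizedE ?gt_eqF//.
have [->|/windowed_supp/andP[vx xw]] := eqVneq (windowed (self_normalize i x)) 0; first by case: ifP.
(* The lower end of the window excludes [x_i = 0], whose default inverse would make the ratio 0. *)
have xi0 : 0 < coordinate i x.
  by rewrite -invr_gt0 -(pmulr_lgt0 _ xj0) (lt_le_trans v0 vx).
suff -> : t < coordinate i x by [].
rewrite -(ltr_pM2l w0) (lt_le_trans tx)//.
by rewrite -ler_pdivrMr// mulrC.
Qed.

End window_functions.

(** * The time-change formula *)

Section time_change.
Context (R : realType) (d : nat).
Context (dT : measure_display) (T : measurableType dT) (P : probability T R).
Context (X : {RV P >-> borel_rV R d}) (XS : forall w, orthant (X w)).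
Context (b : R -> R) (alpha : R) (alpha_gt0 : 0 < alpha).
Context (b_rv : regularly_varying b alpha).
Context (i j : 'I_d) (ci cj : R) (ci0 : 0 < ci) (cj0 : 0 < cj).
Let exceed (i : 'I_d) (t : R) := [set w | t < coordinate i (X w)].
Let Y (i : 'I_d) (w : T) : borel_rV R d := self_normalize i (X w).
Context (bi_lim : ((b t)%:E * P (exceed i t))%E @[t --> +oo] --> ci%:E).
Context (bj_lim : ((b t)%:E * P (exceed j t))%E @[t --> +oo] --> cj%:E).
Context (di : measure_display) (Ti : measurableType di) (Qi : probability Ti R).
Context (dj : measure_display) (Tj : measurableType dj) (Qj : probability Tj R).
Context (Ui : {RV Qi >-> borel_rV R d}) (Uj : {RV Qj >-> borel_rV R d}).
Context (UiS : forall w, orthant (Ui w)) (UjS : forall w, orthant (Uj w)).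
Context (weak_i : weak_cvg_on orthant (pinfty_nbhs R)
  (fun t => cond_law P (exceed i t) (Y i)) (distribution Qi Ui)).
Context (weak_j : weak_cvg_on orthant (pinfty_nbhs R)
  (fun t => cond_law P (exceed j t) (Y j)) (distribution Qj Uj)).

(** Passes the pathwise squeeze to normalised expectations: [b r] is positive for large [r]. The
    thresholds [s] and [t] will be [r], [v r] or [w r]. *)
Lemma exceed_integral_near_le (k l : 'I_d) (s t : R -> R) (g h : 'rV[R]_d -> R) :
  continuous g -> continuous h -> (forall x, 0 <= g x) -> (forall x, 0 <= h x) ->
  (forall r x, 0 < r -> orthant x ->
    (if s r < coordinate k x then g (self_normalize k x) else 0) <=
    (if t r < coordinate l x then h (self_normalize l x) else 0)) ->
  \forall r \near +oo, ((b r)%:E * \int[P]_(w in exceed k (s r)) (g (Y k w))%:E <=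
    (b r)%:E * \int[P]_(w in exceed l (t r)) (h (Y l w))%:E)%E.
Proof.
move=> cg ch g0 h0 gh; have [[a [_ ba]] _] := b_rv.
near=> r.
have br : 0 <= b r by rewrite ltW//; apply: ba; near: r; apply: nbhs_pinfty_gt; exact: num_real.
have r0 : 0 < r by near: r; apply: nbhs_pinfty_gt; exact: num_real.
rewrite lee_wpmul2l ?lee_fin// !(integral_mkcond (exceed _ _)).
have mF (m : 'I_d) u (f : 'rV[R]_d -> R) : continuous f ->
    measurable_fun setT ((fun w => (f (Y m w))%:E : \bar R) \_ (exceed m u)).
  move=> cf; apply/(measurable_restrictT _ (measurable_exceed X m u)).1.
  apply/measurable_funTS/measurable_EFinP; apply: measurableT_comp (measurable_normalized _ _).
  exact: continuous_measurable_rV.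
apply: ge0_le_integral => //.
- by move=> w _; rewrite patchE; case: ifP => // _; rewrite lee_fin.
- exact: mF.
- exact: mF.
- move=> w _; rewrite !patchE.
  have E m u f : (if w \in exceed m u then (f (Y m w))%:E else 0%E) =
      (if u < coordinate m (X w) then f (self_normalize m (X w)) else 0)%:E :> \bar R.
    have [um|um] := boolP (u < coordinate m (X w)).
      by rewrite mem_set.
    by rewrite memNset//; exact/negP.
  by rewrite !E lee_fin; exact: gh.
Unshelve. all: by end_near. Qed.

Section window.
Context (g : 'rV[R]_d -> R) (phi : R -> R).
Context (cg : continuous g) (g01 : forall x, 0 <= g x <= 1).
Context (cphi : continuous phi) (phi01 : forall x, 0 <= phi x <= 1).
Context (v w : R) (v0 : 0 < v) (vw : v < w).
Context (phi_supp : forall x, phi x != 0 -> v <= x <= w).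

Local Notation Gi := (windowed j g phi).
Local Notation Gj := (renormalized i g phi).

Local Notation Ai := (ci%:E * \int[Qi]_x (Gi (Ui x))%:E)%E.
Local Notation Aj := (cj%:E * \int[Qj]_x (Gj (Uj x))%:E)%E.

Let Gi01 := windowed_ge0_le1 j g01 phi01.
Let Gj01 := renormalized_ge0_le1 i g01 phi01.
Let cGi : continuous Gi := windowed_continuous cg cphi.
Let cGj : continuous Gj.
Proof. by apply: renormalized_continuous; eassumption. Qed.
Let Gi0 x : 0 <= Gi x. Proof. by case/andP: (Gi01 x). Qed.
Let Gj0 x : 0 <= Gj x. Proof. by case/andP: (Gj01 x). Qed.

(** The limit of [windowed_le]: the threshold [v t] contributes the factor [v^(-alpha)]. *)
Lemma windowed_limit_le : (Ai <= ((v `^ alpha)^-1)%:E * Aj)%E.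
Proof.
have Hi := tail_cvg XS bi_lim UiS weak_i cGi Gi01.
have Hj := tail_scale_cvg XS b_rv bj_lim UjS weak_j v0 cGj Gj01.
rewrite -(cvg_lim _ Hi)// -(cvg_lim _ Hj)//.
apply: lee_lim; [by apply/cvg_ex; eexists; exact: Hi|by apply/cvg_ex; eexists; exact: Hj|].
apply: (@exceed_integral_near_le i j id (fun t => v * t)) => // r x r0 xS.
exact: (windowed_le i j g01 phi01 v0 phi_supp r0 xS).
Qed.

Lemma renormalized_limit_le : (((w `^ alpha)^-1)%:E * Aj <= Ai)%E.
Proof.
have Hi := tail_cvg XS bi_lim UiS weak_i cGi Gi01.
have Hj := tail_scale_cvg XS b_rv bj_lim UjS weak_j (lt_trans v0 vw) cGj Gj01.
rewrite -(cvg_lim _ Hi)// -(cvg_lim _ Hj)//.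
apply: lee_lim; [by apply/cvg_ex; eexists; exact: Hj|by apply/cvg_ex; eexists; exact: Hi|].
apply: (@exceed_integral_near_le j i (fun t => w * t) id) => // r x r0 xS.
exact: (renormalized_le i j g01 phi01 v0 vw phi_supp r0 xS).
Qed.

Let powR_div : ((w / v) `^ alpha = w `^ alpha * (v `^ alpha)^-1)%R.
Proof.
have w0 := lt_trans v0 vw.
apply/(canRL (mulfK _)); first by rewrite gt_eqF// powR_gt0.
by rewrite -powRM ?divfK ?gt_eqF// ?divr_ge0// ltW.
Qed.

Let mUj : measurable_fun setT Uj. Proof. by []. Qed.

Let mGj : measurable_fun setT (fun x => Gj (Uj x)).
Proof. exact: (measurableT_comp (continuous_measurable_rV cGj) mUj). Qed.

Let mpow : measurable_fun setT (fun x => coordinate i (Uj x) `^ alpha).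
Proof.
exact: (measurableT_comp (measurable_powR alpha) (measurableT_comp (measurable_coordinate i) mUj)).
Qed.

Let w0 : 0 < w := lt_trans v0 vw.
Let cj_ge0 : 0 <= cj := ltW cj0.
Let ci_ge0 : 0 <= ci := ltW ci0.
Let v_ge0 : 0 <= v := ltW v0.
Let w_ge0 : 0 <= w := ltW w0.
Let weight_ge0 x : 0 <= cj * (Gj (Uj x) * coordinate i (Uj x) `^ alpha).
Proof. by apply: mulr_ge0 => //; apply: mulr_ge0 => //; exact: powR_ge0. Qed.

Local Notation Aj_weighted :=
  (\int[Qj]_x (cj * (Gj (Uj x) * coordinate i (Uj x) `^ alpha))%:E)%E.

Let AjE : Aj = (\int[Qj]_x (cj * Gj (Uj x))%:E)%E.
Proof.
rewrite -ge0_integralZl_EFin//; first by move=> x _; rewrite lee_fin.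
exact/measurable_EFinP.
Qed.

Let AiE : Ai = (\int[Qi]_x (ci * g (Ui x) * phi (coordinate j (Ui x)))%:E)%E.
Proof.
have mUi : measurable_fun setT Ui by [].
rewrite -ge0_integralZl_EFin//.
- by apply: eq_integral => x _; rewrite -EFinM mulrA.
- by move=> x _; rewrite lee_fin.
- by apply/measurable_EFinP; exact: (measurableT_comp (continuous_measurable_rV cGi) mUi).
Qed.

Let Aj_weightedE : Aj_weighted =
  (\int[Qj]_x (cj * (g (self_normalize i (Uj x)) * coordinate i (Uj x) `^ alpha)
               * phi (coordinate i (Uj x))^-1)%:E)%E.
Proof. by apply: eq_integral => x _; congr EFin; rewrite -[RHS]mulrA; congr (_ * _); rewrite mulrAC. Qed.

Let mcGj : measurable_fun setT (fun x => cj * Gj (Uj x)).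
Proof. exact: measurable_funM. Qed.

Let mweight : measurable_fun setT
  (fun x => cj * (Gj (Uj x) * coordinate i (Uj x) `^ alpha)).
Proof. by apply: measurable_funM => //; exact: measurable_funM. Qed.

Let pow1 : (1 : R) `^ alpha = 1. Proof. by rewrite powR1. Qed.

(** On the support of [Gj] the coordinate [y_i] is at least [1 / w], hence [1 <= (w y_i)^alpha].
    This trades a constant depending on the window for the weight [y_i^alpha]. *)
Lemma renormalized_weight_le : (Aj <= (w `^ alpha)%:E * Aj_weighted)%E.
Proof.
have wa0 : 0 <= w `^ alpha by exact: powR_ge0.
rewrite AjE -ge0_integralZl_EFin//; last 2 first.
- by move=> x _; rewrite lee_fin.
- exact/measurable_EFinP.
apply: ge0_le_integral => //.
- by move=> x _; rewrite lee_fin mulr_ge0.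
- exact/measurable_EFinP.
- by apply/measurable_EFinP; exact: measurable_funM.
move=> x _; rewrite -EFinM lee_fin (mulrCA (w `^ alpha) cj) ler_wpM2l//.
have [->|/(renormalized_supp v0 vw phi_supp)/andP[wx _]] := eqVneq (Gj (Uj x)) 0.
  by rewrite mul0r mulr0.
have x0 : 0 < coordinate i (Uj x) by rewrite (lt_le_trans _ wx)// invr_gt0.
have x_ge0 := ltW x0.
rewrite (mulrCA (w `^ alpha)) ler_peMr// -powRM// -[leLHS]pow1.
rewrite ge0_ler_powR ?nnegrE ?mulr_ge0 ?(ltW alpha_gt0)//.
by rewrite -ler_pdivrMl// mulr1.
Qed.

(** On the support of [Gj] also [y_i <= 1 / v], hence [(v y_i)^alpha <= 1]. *)
Lemma weight_renormalized_le : (Aj_weighted <= ((v `^ alpha)^-1)%:E * Aj)%E.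
Proof.
have va0 : 0 <= (v `^ alpha)^-1 by rewrite invr_ge0 powR_ge0.
rewrite AjE -ge0_integralZl_EFin//; last 2 first.
- by move=> x _; rewrite lee_fin mulr_ge0.
- exact/measurable_EFinP.
apply: ge0_le_integral => //.
- by move=> x _; rewrite lee_fin.
- exact/measurable_EFinP.
- by apply/measurable_EFinP; exact: measurable_funM.
move=> x _; rewrite -EFinM lee_fin (mulrCA _^-1 cj) ler_wpM2l//.
have [->|/(renormalized_supp v0 vw phi_supp)/andP[wx xv]] := eqVneq (Gj (Uj x)) 0.
  by rewrite mul0r mulr0.
have x0 : 0 < coordinate i (Uj x) by rewrite (lt_le_trans _ wx)// invr_gt0.
have x_ge0 := ltW x0.
rewrite mulrC ler_wpM2r// -[leRHS]mul1r ler_pdivlMr ?powR_gt0//.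
rewrite -powRM// -[leRHS]pow1.
rewrite ge0_ler_powR ?nnegrE ?mulr_ge0 ?(ltW alpha_gt0)//.
by rewrite -ler_pdivlMr// mul1r.
Qed.

Lemma windowed_le_weighted :
  (\int[Qi]_x (ci * g (Ui x) * phi (coordinate j (Ui x)))%:E <=
   ((w / v) `^ alpha)%:E *
   \int[Qj]_x (cj * (g (self_normalize i (Uj x)) * coordinate i (Uj x) `^ alpha)
               * phi (coordinate i (Uj x))^-1)%:E)%E.
Proof.
rewrite -Aj_weightedE -AiE powR_div mulrC EFinM -muleA.
apply: le_trans windowed_limit_le _; rewrite lee_wpmul2l ?lee_fin ?invr_ge0 ?powR_ge0//.
exact: renormalized_weight_le.
Qed.

Lemma weighted_le_windowed :
  (\int[Qj]_x (cj * (g (self_normalize i (Uj x)) * coordinate i (Uj x) `^ alpha)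
               * phi (coordinate i (Uj x))^-1)%:E <=
   ((w / v) `^ alpha)%:E *
   \int[Qi]_x (ci * g (Ui x) * phi (coordinate j (Ui x)))%:E)%E.
Proof.
rewrite -Aj_weightedE -AiE powR_div mulrC EFinM -muleA.
apply: le_trans weight_renormalized_le _; rewrite lee_wpmul2l ?lee_fin ?invr_ge0 ?powR_ge0//.
by rewrite -lee_pdivrMl ?powR_gt0//; exact: renormalized_limit_le.
Qed.

End window.

(** The window estimates hold in both directions, so [le_integral_windows] gives two inequalities.
    The windowed variable is [Theta_ij] on one side and [1 / Theta_ji] on the other; as [0^-1 = 0],
    its positivity means [Theta_ji > 0]. *)
Lemma time_change_continuous (g : 'rV[R]_d -> R) :
  continuous g -> (forall x, 0 <= g x <= 1) ->
  (\int[Qi]_x (ci * g (Ui x) * \1_[set y : R | 0 < y] (coordinate j (Ui x)))%:E =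
   \int[Qj]_x (cj * (g (self_normalize i (Uj x)) * coordinate i (Uj x) `^ alpha)
               * \1_[set y : R | 0 < y] (coordinate i (Uj x))^-1)%:E)%E.
Proof.
move=> cg g01; have g0 x : 0 <= g x by case/andP: (g01 x).
have mg := continuous_measurable_rV cg.
have mUi : measurable_fun setT Ui by [].
have mUj : measurable_fun setT Uj by [].
have m1 : measurable_fun setT (fun x => ci * g (Ui x)).
  by apply: measurable_funM => //; exact: measurableT_comp.
have m2 : measurable_fun setT (fun x => coordinate j (Ui x)).
  exact: measurableT_comp (measurable_coordinate j) _.
have m3 : measurable_fun setT (fun x => coordinate i (Uj x)).
  exact: measurableT_comp (measurable_coordinate i) _.
have m4 : measurable_fun setT
    (fun x => cj * (g (self_normalize i (Uj x)) * coordinate i (Uj x) `^ alpha)).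
  apply: measurable_funM => //; apply: measurable_funM.
    exact: (measurableT_comp mg (measurableT_comp (measurable_self_normalize i) mUj)).
  exact: (measurableT_comp (measurable_powR alpha) m3).
have m5 : measurable_fun setT (fun x => (coordinate i (Uj x))^-1).
  exact: measurableT_comp measurable_invr m3.
have n1 x : 0 <= ci * g (Ui x) by rewrite mulr_ge0// ltW.
have n2 x : 0 <= cj * (g (self_normalize i (Uj x)) * coordinate i (Uj x) `^ alpha).
  by rewrite !mulr_ge0 ?powR_ge0// ltW.
apply/eqP; rewrite eq_le; apply/andP; split.
- apply: (le_integral_windows m1 m2 m4 m5 n1 n2 (alpha := alpha)) => v w phi v0 vw cphi phi01 supp.
  exact: windowed_le_weighted.
- apply: (le_integral_windows m4 m5 m1 m2 n2 n1 (alpha := alpha)) => v w phi v0 vw cphi phi01 supp.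
  exact: weighted_le_windowed.
Qed.

(** Each side is the integral of [h] against the pushforward of a weighted probability measure. The
    two pushforwards agree on continuous functions with values in [[0, 1]], hence on Borel sets. *)
Lemma time_change (h : borel_rV R d -> \bar R) :
  measurable_fun setT h -> (forall x, 0 <= h x)%E ->
  (\int[Qi]_x (h (Ui x) * (ci * \1_[set y : R | 0 < y] (coordinate j (Ui x)))%:E) =
   \int[Qj]_x (h (self_normalize i (Uj x)) *
     (cj * coordinate i (Uj x) `^ alpha *
      \1_[set y : R | 0 < y] (coordinate i (Uj x))^-1)%:E))%E.
Proof.
move=> mh h0.
have mUi : measurable_fun setT Ui by [].
have mUj : measurable_fun setT Uj by [].
have mVj : measurable_fun setT (fun x => self_normalize i (Uj x) : borel_rV R d).
  exact: (measurableT_comp (measurable_self_normalize i) mUj).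
have m3 : measurable_fun setT (fun x => coordinate i (Uj x)).
  exact: (measurableT_comp (measurable_coordinate i) mUj).
have mpos : measurable_fun setT (\1_[set y : R | (0 < y)%R] : R -> R).
  apply: measurable_indic.
  rewrite (_ : [set _ | _] = `]0%R, +oo[%classic) //.
  by apply/seteqP; split => y /=; rewrite in_itv/= andbT.
pose w1 x : \bar R := (ci * \1_[set y : R | 0 < y] (coordinate j (Ui x)))%:E.
pose w2 x : \bar R := (cj * coordinate i (Uj x) `^ alpha *
      \1_[set y : R | 0 < y] (coordinate i (Uj x))^-1)%:E.
have mw1 : measurable_fun setT w1.
  apply/measurable_EFinP; apply: measurable_funM => //.
  exact: (measurableT_comp mpos (measurableT_comp (measurable_coordinate j) mUi)).
have mw2 : measurable_fun setT w2.
  apply/measurable_EFinP; apply: measurable_funM.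
    by apply: measurable_funM => //; exact: (measurableT_comp (measurable_powR alpha) m3).
  exact: (measurableT_comp mpos (measurableT_comp measurable_invr m3)).
have w1_ge0 x : (0 <= w1 x)%E by rewrite lee_fin mulr_ge0// ltW.
have w2_ge0 x : (0 <= w2 x)%E by rewrite lee_fin !mulr_ge0 ?powR_ge0// ltW.
pose m1 : {measure set (borel_rV R d) -> \bar R} :=
  pushforward (weighted (Qi : {measure set _ -> \bar R}) mw1 w1_ge0) Ui.
pose V x : borel_rV R d := self_normalize i (Uj x).
pose m2 : {measure set (borel_rV R d) -> \bar R} :=
  pushforward (weighted (Qj : {measure set _ -> \bar R}) mw2 w2_ge0) V.
have m1E (k : borel_rV R d -> \bar R) : measurable_fun setT k -> (forall x, 0 <= k x)%E ->
    (\int[m1 mUi]_x k x = \int[Qi]_x (k (Ui x) * w1 x))%E.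
  move=> mk k0; rewrite ge0_integral_pushforward//= ge0_integral_weighted//.
  exact: (measurableT_comp mk mUi).
have m2E (k : borel_rV R d -> \bar R) : measurable_fun setT k -> (forall x, 0 <= k x)%E ->
    (\int[m2 mVj]_x k x = \int[Qj]_x (k (V x) * w2 x))%E.
  move=> mk k0; rewrite ge0_integral_pushforward//= ge0_integral_weighted//.
  exact: (measurableT_comp mk mVj).
rewrite -m1E// -[RHS]m2E//; apply: eq_measure_integral => A mA _.
apply: measure_rV_unique mA; last first.
  move=> g cg g01; have g0 x : (0 <= (g x)%:E)%E by rewrite lee_fin; case/andP: (g01 x).
  have mg : measurable_fun setT (fun x : borel_rV R d => (g x)%:E).
    by apply/measurable_EFinP; exact: continuous_measurable_rV.
  rewrite m1E// m2E//; have := time_change_continuous cg g01.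
  under eq_integral do rewrite (mulrC ci) -mulrA EFinM.
  move=> ->; apply: eq_integral => x _.
  by rewrite -EFinM; congr EFin; rewrite mulrCA !mulrA.
(* Finite mass: the density [w1] is at most [ci] and [Qi] is a probability. *)
apply: (@le_lt_trans _ _ (\int[Qi]_x (cst ci%:E x))%E); last first.
  by rewrite integral_cst//= -ge0_fin_numE ?mule_ge0 ?lee_fin ?(ltW ci0)// fin_numM// fin_num_measure.
rewrite -[leLHS]/(\int[Qi]_x w1 x)%E; apply: ge0_le_integral => //.
by move=> x _; rewrite lee_fin ler_piMr ?(ltW ci0)// indicE.
Qed.

End time_change.

(** * The radial integral and its homogeneity *)

Section radial_integral.
Context {R : realType} {d : nat} (alpha : R) (alpha_gt0 : 0 < alpha).
Context (F : borel_rV R d -> \bar R).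
Context (mF : measurable_fun setT F) (F_ge0 : forall x, (0 <= F x)%E).

Let k (z : R) : \bar R := (alpha * z `^ (- alpha - 1))%:E.

Let k_ge0 z : (0 <= k z)%E.
Proof. by rewrite lee_fin mulr_ge0 ?powR_ge0// ltW. Qed.

Let mk : measurable_fun setT k.
Proof. by apply/measurable_EFinP; apply: measurable_funM => //; exact: measurable_powR. Qed.

Definition radial_integral (x : 'rV[R]_d) : \bar R :=
  (\int[lebesgue_measure]_(z in `]0%R, +oo[) (F (z *: x)%R * (alpha * z `^ (- alpha - 1))%:E))%E.

Lemma radial_integral_ge0 x : (0 <= radial_integral x)%E.
Proof. by apply: integral_ge0 => z _; rewrite mule_ge0//; exact: k_ge0. Qed.

Lemma measurable_radial_integral : measurable_fun [set: borel_rV R d] radial_integral.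
Proof.
(* The half-line enters as an indicator, so that Tonelli's theorem applies on the whole product
   space. *)
pose G (p : borel_rV R d * measurableTypeR R) : \bar R :=
  ((F (p.2 *: (p.1 : 'rV[R]_d))%R * k p.2) * (\1_(`]0%R, +oo[%classic : set R) p.2)%:E)%E.
have mG : measurable_fun setT G.
  apply: emeasurable_funM; last first.
    apply/measurable_EFinP; apply: (@measurableT_comp _ _ _ _ _ _ (\1_(`]0%R, +oo[%classic : set R) : R -> R)) => //.
  apply: emeasurable_funM; last exact: (measurableT_comp mk measurable_snd).
  apply: (measurableT_comp mF).
  exact: measurable_scale_rV.
have G0 p : (0 <= G p)%E by rewrite /G !mule_ge0// lee_fin.
have := @measurable_fun_fubini_tonelli_F _ _ (borel_rV R d) (measurableTypeR R) R (@lebesgue_measure R) G mG G0.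
congr measurable_fun; apply/funext => x; rewrite /fubini_F /radial_integral [RHS]integral_mkcond.
apply: eq_integral => z _; rewrite patchE /G/= indicE.
by case: ifPn => _; rewrite ?mule1 ?mule0.
Qed.

(** Homogeneity of degree [alpha]. Replacing [z] by [a z] yields a Jacobian [a] and a factor
    [a^(-alpha-1)] from the density, which together cancel [a^alpha]. *)
Lemma radial_integral_scale (a : R) (x : 'rV[R]_d) : 0 < a ->
  radial_integral x = ((a `^ alpha)%:E * radial_integral (a^-1 *: x))%E.
Proof.
move=> a0; have a_ge0 := ltW a0.
have mFs y : measurable_fun [set: R] (fun z : R => (F (z *: y)%R * k z)%E).
  apply: emeasurable_funM; last exact: mk.
  by apply: (measurableT_comp mF); apply: measurable_scale_rV.
rewrite /radial_integral [in RHS](ge0_integral_scale a0); last 2 first.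
- exact: mFs.
- by move=> z; rewrite mule_ge0//; exact: k_ge0.
have -> : (\int[lebesgue_measure]_(z in `]0%R, +oo[)
      (F ((a * z) *: (a^-1 *: x))%R * (alpha * (a * z) `^ (- alpha - 1))%:E) =
    \int[lebesgue_measure]_(z in `]0%R, +oo[)
      ((a `^ (- alpha - 1))%:E * (F (z *: x)%R * k z)))%E.
  apply: eq_integral => z; rewrite inE/= in_itv/= andbT => z0.
  rewrite scalerA mulrAC divff ?gt_eqF// mul1r powRM// ?(ltW z0)// muleCA -EFinM.
  by rewrite mulrCA.
rewrite ge0_integralZl_EFin ?powR_ge0//; last 2 first.
- by move=> z _; rewrite mule_ge0.
- exact: (measurable_funTS (mFs x)).
rewrite !muleA -!EFinM -[X in _ * X * _]powRr1// -!powRD ?(gt_eqF a0) ?implybT//.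
by rewrite addrAC addrA addrAC subrr add0r subrr powRr0 mul1e.
Qed.

End radial_integral.

(** * Exchange of the two indices for Borel functions off the origin *)

Theorem corollary3p1 (R : realType) (d : nat)
    (dT : measure_display) (T : measurableType dT) (P : probability T R)
    (X : {RV P >-> borel_rV R d}) (XS : forall w, orthant (X w))
    (I : {set 'I_d}) (I_neq0 : I != finset.set0)
    (b : R -> R) (alpha : R) (alpha_gt0 : 0 < alpha)
    (b_rv : regularly_varying b alpha)
    (c : 'I_d -> R) (c_gt0 : forall i, i \in I -> 0 < c i)
    (b_lim : forall i, i \in I ->
      ((b t)%:E * P [set w | (t < coordinate i (X w))%R])%E @[t --> +oo] --> (c i)%:E)
    (dT' : 'I_d -> measure_display) (T' : forall i, measurableType (dT' i))
    (Q : forall i, probability (T' i) R)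
    (Theta : forall i, {RV (Q i) >-> borel_rV R d})
    (ThetaS : forall i, i \in I -> forall w, orthant (Theta i w))
    (weak_lim : forall i, i \in I ->
      weak_cvg_on orthant (pinfty_nbhs R)
        (fun t => cond_law P [set w | t < coordinate i (X w)]
                    (fun w => self_normalize i (X w) : borel_rV R d))
        (distribution (Q i) (Theta i)))
    (f : borel_rV R d -> \bar R)
    (f_meas : measurable_fun (orthant_off0 I : set (borel_rV R d)) f)
    (f_ge0 : forall x, orthant_off0 I x -> (0 <= f x)%E) :
  forall i j, i \in I -> j \in I ->
  ((c j)%:E * \int[Q j]_w
     ((\1_[set w | (0 < coordinate i (Theta j w))%R] w)%:E *
      \int[lebesgue_measure]_(z in `]0%R, +oo[)
        ((f \_ (orthant_off0 I)) (z *: (Theta j w : 'rV[R]_d))%R *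
         (alpha * z `^ (- alpha - 1))%:E))
   = (c i)%:E * \int[Q i]_w
     ((\1_[set w | (0 < coordinate j (Theta i w))%R] w)%:E *
      \int[lebesgue_measure]_(z in `]0%R, +oo[)
        ((f \_ (orthant_off0 I)) (z *: (Theta i w : 'rV[R]_d))%R *
         (alpha * z `^ (- alpha - 1))%:E)))%E.
Proof.
move=> i j iI jI.
(* Extension of [f] by 0 gives a nonnegative Borel function on all of [R^d], as the radial integral
   requires. *)
pose F : borel_rV R d -> \bar R := f \_ (orthant_off0 I).
have F_ge0 x : (0 <= F x)%E.
  by rewrite /F patchE; case: ifPn => // /set_mem; exact: f_ge0.
have mF : measurable_fun setT F.
  exact: ((measurable_restrictT _ (measurable_orthant_off0 I)).1 f_meas).
pose h := radial_integral alpha F.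
have h_ge0 := radial_integral_ge0 alpha_gt0 F_ge0 : forall x, (0 <= h x)%E.
have mh : measurable_fun [set: borel_rV R d] h := measurable_radial_integral alpha_gt0 mF F_ge0.
have ci0 := c_gt0 i iI; have cj0 := c_gt0 j jI.
have mpos k l : measurable_fun setT
    (fun x => (\1_[set w | 0 < coordinate l (Theta k w)] x)%:E : \bar R).
  apply/measurable_EFinP; apply: measurable_indic.
  rewrite (_ : [set _ | _] = (coordinate l \o Theta k) @^-1` `]0, +oo[%classic).
    rewrite -[X in measurable X]setTI; apply: measurableT_comp => //.
    exact: measurable_coordinate.
  by apply/seteqP; split => w; rewrite /= in_itv/= andbT.
have mhT k : measurable_fun setT (fun x => h (Theta k x)).
  exact: measurableT_comp mh _.
rewrite -!ge0_integralZl_EFin ?(ltW ci0) ?(ltW cj0)//; last 4 first.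
- by move=> x _; rewrite mule_ge0 ?lee_fin//; exact: h_ge0.
- by apply: emeasurable_funM => //; exact: mhT.
- by move=> x _; rewrite mule_ge0 ?lee_fin//; exact: h_ge0.
- by apply: emeasurable_funM => //; exact: mhT.
have tc := time_change XS alpha_gt0 b_rv ci0 cj0 (b_lim i iI) (b_lim j jI) (ThetaS i iI)
  (ThetaS j jI) (weak_lim i iI) (weak_lim j jI) mh h_ge0.
transitivity (\int[Q j]_x (h (self_normalize i (Theta j x)) *
    (c j * coordinate i (Theta j x) `^ alpha *
     \1_[set y : R | (0 < y)%R] (coordinate i (Theta j x))^-1)%:E))%E; last first.
  by rewrite -tc; apply: eq_integral => x _; rewrite [RHS]muleA -EFinM muleC.
apply: eq_integral => x _; rewrite -/(radial_integral alpha F (Theta j x)).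
(* If [Theta_ji > 0], homogeneity with [a = Theta_ji] absorbs the weight [Theta_ji^alpha]; otherwise
   both indicators vanish, at 0 because of the default inverse. *)
have [x0|x0] := ltP 0 (coordinate i (Theta j x)).
  rewrite !indicE !mem_set/= ?invr_gt0// mulr1 mul1e.
  rewrite (radial_integral_scale alpha_gt0 mF F_ge0 _ x0).
  by rewrite muleA -EFinM muleC.
rewrite !indicE !memNset/= ?mulr0 ?mul0e ?mule0//.
  by rewrite /= invr_gt0; apply/negP; rewrite -leNgt.
by rewrite /=; apply/negP; rewrite -leNgt.
Qed.
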